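(* Let $s$ be a scalar real-valued query with global sensitivity $0<\Delta<\infty$, and let $\epsilon>0$ and $\delta\in(0,1)$. Consider the Gaussian mechanism of $(\epsilon,\delta)$-probabilistic differential privacy, which perturbs $s$ with Gaussian noise of mean $0$ and standard deviation $$\sigma=(2\epsilon)^{-1}\Delta\left(\sqrt{(\Phi^{-1}(\delta/2))^2+2\epsilon}-\Phi^{-1}(\delta/2)\right),$$ and the Laplace mechanism of $\epsilon$-differential privacy, which perturbs $s$ with Laplace noise of mean $0$ and scale $\Delta/\epsilon$ (variance $2(\Delta/\epsilon)^2$). If $\delta<2\Phi(-\sqrt{2})\approx0.157$, then the variance of the Gaussian distribution in the Gaussian mechanism is always greater than the variance of the Laplace distribution in the Laplace mechanism, i.e. $\sigma^2>2(\Delta/\epsilon)^2$.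
   Context: $\Phi$ is the cumulative distribution function of the standard normal distribution. The global sensitivity of the scalar query $s$ is $\Delta=\max_{d(\mathbf{x},\mathbf{x}')=1}|s(\mathbf{x})-s(\mathbf{x}')|$ over neighboring data sets (differing by one individual). The stated $\sigma$ and Laplace scale are the smallest ones given by the paper's calibrations of the two mechanisms. *)

(* Defs.v *)
From HB Require Import structures.
From mathcomp Require Import all_boot all_order all_algebra.
From mathcomp Require Import all_classical all_reals all_analysis.
From mathcomp Require Import measurable_realfun.

Set Implicit Arguments.
Unset Strict Implicit.
Unset Printing Implicit Defensive.
Import Order.TTheory GRing.Theory Num.Theory.
Import numFieldNormedType.Exports.
Local Open Scope classical_set_scope.
Local Open Scope ring_scope.

(* The supremum is taken in the extended reals: it is the maximum over
   neighbouring data sets whenever that maximum is attained, it is +oo when the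
   differences are unbounded, and it is -oo when there are no neighbours. *)
Definition global_sensitivity (R : realType) (D : Type) (d : D -> D -> nat)
    (s : D -> R) : \bar R :=
  ereal_sup [set y | exists x x' : D,
                       d x x' = 1%N /\ y = (`|s x - s x'|)%:E].

Section standard_normal.
Context {R : realType}.

Definition Phi (x : R) : R := fine (normal_prob (0 : R) 1 `]-oo, x]).

(* Only meaningful on ]0, 1[, the range of Phi. *)
Definition Phi_inv : R -> R := 'pinv_(fun=> 0) [set: R] Phi.

End standard_normal.

Section laplace_density.
Context {R : realType}.
Implicit Types m b x : R.

(* As for [normal_pdf], a junk density is used for degenerate parameters, so
   that [laplace_prob m b] is a probability measure for all m and b. *)
Definition laplace_pdf m b x : R :=
  if 0 < b then (b *+ 2)^-1 * expR (- (`|x - m| / b)) else \1_`[0, 1] x.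

Lemma laplace_pdf_ge0 m b x : 0 <= laplace_pdf m b x.
Proof.
rewrite /laplace_pdf; case: ifPn => // b0.
by rewrite mulr_ge0 ?expR_ge0// invr_ge0 mulrn_wge0// ltW.
Qed.

Lemma measurable_laplace_pdf m b : measurable_fun setT (laplace_pdf m b).
Proof.
rewrite /laplace_pdf; have [b0|b0] := boolP (0 < b).
  apply: measurable_funM => //; apply: measurableT_comp => //.
  apply: measurableT_comp => //; apply: measurable_funM => //.
  by apply: measurableT_comp => //; exact: measurable_funB.
exact: measurable_indic.
Qed.

Lemma continuous_laplace_pdf m b : 0 < b -> continuous (laplace_pdf m b).
Proof.
move=> b0; rewrite /laplace_pdf b0 => x.
apply: cvgM; first exact: cvg_cst.
apply: (cvg_comp _ expR); last exact: continuous_expR.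
apply: (@cvgN _ R^o); apply: cvgM; last exact: cvg_cst.
apply: (@cvg_norm _ R^o); apply: (@cvgB _ R^o); first exact: cvg_id.
exact: cvg_cst.
Qed.

End laplace_density.

Definition laplace_prob {R : realType} (m b : R) : set _ -> \bar R :=
  fun V => (\int[lebesgue_measure]_(x in V) (laplace_pdf m b x)%:E)%E.

Section laplace_probability.
Context {R : realType} (m b : R).
Notation mu := lebesgue_measure.

Let integral_laplace_center : 0 < b ->
  (\int[mu]_x (laplace_pdf 0 b x)%:E = 1)%E.
Proof.
move=> b0.
rewrite ge0_symfun_integralT//.
- transitivity (2%:E * \int[mu]_(x in `[0%R, +oo[)
      ((2^-1)%:E * (exponential_pdf b^-1 x)%:E))%E.
    rewrite -set_itvcy; congr *%E.
    apply: eq_integral => x; rewrite inE/= in_itv/= andbT => x0.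
    rewrite /laplace_pdf b0 subr0 ger0_norm// exponential_pdfE// -EFinM.
    by rewrite -[b *+ 2]mulr_natl invfM mulNr [b^-1 * x]mulrC mulrA.
  have b1 : 0 < b^-1 by rewrite invr_gt0.
  rewrite ge0_integralZl_EFin//=.
  + have -> : (\int[mu]_(x in `[0%R, +oo[) (exponential_pdf b^-1 x)%:E = 1)%E.
      rewrite -(integral_exponential_pdf b1) integral_mkcond.
      apply: eq_integral => x _; rewrite patchE; case: ifPn => // xN.
      by rewrite /exponential_pdf patchE (negbTE xN).
    by rewrite mule1 -EFinM divff.
  + by move=> x _; rewrite lee_fin exponential_pdf_ge0// ltW.
  + apply/measurable_EFinP/measurable_funTS; exact: measurable_exponential_pdf.
- by move=> x; exact: laplace_pdf_ge0.
- exact: continuous_laplace_pdf.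
- by move=> x; rewrite /= /laplace_pdf b0 !subr0 normrN.
Qed.

Lemma integral_laplace_pdf : (\int[mu]_x (laplace_pdf m b x)%:E = 1)%E.
Proof.
have [b0|b0] := boolP (0 < b); last first.
  rewrite /laplace_pdf (negbTE b0) integral_indic//= setIT.
  by rewrite lebesgue_measure_itv/= lte01 oppr0 adde0.
pose F (x : R^o) : R^o := x - m.
have F'E : F^`()%classic = cst 1.
  apply/funext => x; rewrite /F derive1E deriveB// derive_cst subr0.
  by rewrite derive_id.
rewrite -(integral_laplace_center b0).
rewrite [RHS](@increasing_ge0_integration_by_substitutionT _ F)//.
- apply: eq_integral => x _; rewrite F'E !fctE /= mulr1.
  by rewrite /laplace_pdf b0 subr0.
- by move=> x y xy; rewrite /F ltrD2r.
- by rewrite F'E => ?; exact: cvg_cst.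
- by rewrite F'E; exact: is_cvg_cst.
- by rewrite F'E; exact: is_cvg_cst.
- exact: cvg_addrr_Ny.
- exact: cvg_addrr.
- exact: continuous_laplace_pdf.
- by move=> x; exact: laplace_pdf_ge0.
Qed.

Lemma integrable_laplace_pdf :
  mu.-integrable [set: R] (fun x => (laplace_pdf m b x)%:E).
Proof.
apply/integrableP; split.
  by apply/measurable_EFinP; exact: measurable_laplace_pdf.
under eq_integral do rewrite /= ger0_norm ?laplace_pdf_ge0//.
by rewrite integral_laplace_pdf ltry.
Qed.

Local Notation laplace := (laplace_prob m b).

Let laplace0 : laplace set0 = 0%E.
Proof. by rewrite /laplace_prob integral_set0. Qed.

Let laplace_ge0 A : (0 <= laplace A)%E.
Proof. by apply: integral_ge0 => x _; rewrite lee_fin laplace_pdf_ge0. Qed.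

Let laplace_sigma_additive : semi_sigma_additive laplace.
Proof.
move=> /= A mA tA mUA.
rewrite /laplace_prob integral_bigcup//=; last first.
  by apply: (integrableS _ _ (subsetT _)) => //; exact: integrable_laplace_pdf.
apply: is_cvg_ereal_nneg_natsum_cond => n _ _.
by apply: integral_ge0 => /= x ?; rewrite lee_fin laplace_pdf_ge0.
Qed.

HB.instance Definition _ := isMeasure.Build _ _ _
  laplace laplace0 laplace_ge0 laplace_sigma_additive.

Let laplace_setT : laplace [set: _] = 1%E.
Proof. exact: integral_laplace_pdf. Qed.

HB.instance Definition _ :=
  @Measure_isProbability.Build _ _ R laplace laplace_setT.

End laplace_probability.

Section mechanism_noise.
Context {R : realType}.
Implicit Types Delta eps delta : R.

Definition gaussian_sigma Delta eps delta : R :=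
  (2 * eps)^-1 * Delta *
  (Num.sqrt (Phi_inv (delta / 2) ^+ 2 + 2 * eps) - Phi_inv (delta / 2)).

(* The second parameter of [normal_prob] is the standard deviation. *)
Definition gaussian_noise Delta eps delta : probability (measurableTypeR R) R :=
  normal_prob 0 (gaussian_sigma Delta eps delta).

Definition laplace_noise Delta eps : probability (measurableTypeR R) R :=
  laplace_prob 0 (Delta / eps).

Definition law_variance (P : probability (measurableTypeR R) R) : \bar R :=
  variance P (idfun : R -> R).

End mechanism_noise.

(* Main.v *)
(* Put z = Phi_inv (delta / 2). As Phi is continuous and tends to 0 at -oo,
   Phi z = delta / 2 < Phi (- sqrt 2), whence z < - sqrt 2 by monotonicity and
   sigma > (2 eps)^-1 Delta (- 2 z) > sqrt 2 (Delta / eps).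
   The variances of the two laws come from antiderivatives of x^2 times the
   density: - (x^2 / 2 + b x + b^2) e^(- x / b) for the Laplace law, and
   s^2 (G x - x p x) for the normal law with density p and distribution
   function G. *)
Require Import Defs.
From HB Require Import structures.
From mathcomp Require Import all_boot all_order all_algebra.
From mathcomp Require Import all_classical all_reals all_analysis.
From mathcomp Require Import measurable_realfun.
From mathcomp Require Import ring lra.

Set Implicit Arguments.
Unset Strict Implicit.
Unset Printing Implicit Defensive.
Import Order.TTheory GRing.Theory Num.Theory.
Import numFieldNormedType.Exports.
Local Open Scope classical_set_scope.
Local Open Scope ring_scope.

(** * Integration against a measure that has a density *)

Section density.
Context d (T : measurableType d) (R : realType).
Variables (nu : {finite_measure set T -> \bar R}).
Variables (mu : {sigma_finite_measure set T -> \bar R}).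
Variable p : T -> R.
Hypothesis intp : mu.-integrable [set: T] (EFin \o p).
Hypothesis nuE : forall A, measurable A ->
  nu A = (\int[mu]_(x in A) (p x)%:E)%E.

Lemma density_dominates : nu `<< mu.
Proof.
apply/null_content_dominatesP => A mA muA0; rewrite nuE//.
apply: null_set_integral => //.
exact: measurable_funTS (measurable_int mu intp).
Qed.

(** [p] and the Radon-Nikodym derivative of [nu] have the same integral over every measurable set,
    hence agree almost everywhere; the change of variables for the derivative then carries over to
    [p]. *)
Lemma ge0_integral_density (f : T -> \bar R) : (forall x, 0 <= f x)%E ->
  measurable_fun [set: T] f ->
  (\int[nu]_x f x = \int[mu]_x (f x * (p x)%:E))%E.
Proof.
move=> f0 mf; have numu := density_dominates.
rewrite -(Radon_Nikodym_SigmaFinite.change_of_variables numu)//.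
have intg := Radon_Nikodym_SigmaFinite.f_integrable numu.
apply: ae_eq_integral => //.
- by apply: emeasurable_funM => //; exact: measurable_int intg.
- by apply: emeasurable_funM => //; exact: measurable_int intp.
- apply: ae_eqe_mul2l; apply: integral_ae_eq => //.
  + exact: measurable_int intp.
  + move=> A _ mA; rewrite -Radon_Nikodym_SigmaFinite.f_integral//.
    exact: nuE.
Qed.

End density.

(** * Mean and variance of a law with an even continuous density *)

Section symmetric_density.
Context {R : realType}.
Notation mu := (@lebesgue_measure R).

Lemma ge0_integral_oppr (f : R -> R) : (forall x, 0 <= f x) -> continuous f ->
  (\int[mu]_x (f x)%:E = \int[mu]_x (f (- x))%:E)%E.
Proof.
(* Cutting at 0 and folding the negative half-line onto the positive one gives two terms that the
   reflection of [f] merely swaps. *)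
suff splitE (g : R -> R) : (forall x, 0 <= g x) -> continuous g ->
    (\int[mu]_x (g x)%:E = \int[mu]_(x in `[0%R, +oo[) (g x)%:E +
                           \int[mu]_(x in `[0%R, +oo[) (g (- x))%:E)%E.
  move=> f0 cf.
  have cfN : continuous (fun x => f (- x)).
    move=> x; apply: continuous_comp; last exact: cf.
    exact: (@oppr_continuous R^o).
  rewrite splitE// [RHS]splitE// addeC; congr +%E.
  by apply: eq_integral => x _; rewrite opprK.
move=> g0 cg.
have mg : measurable_fun [set: R] g by exact: continuous_measurable_fun.
rewrite -(setUv `[0%R, +oo[%classic) ge0_integral_setU//= ; last 4 first.
  exact: measurableC.
  by apply/measurable_EFinP; rewrite setUv.
  by move=> x _; rewrite lee_fin.
  exact/disj_setPCl.
congr +%E; rewrite setCitvr.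
rewrite integral_itv_bndo_bndc; last exact/measurable_EFinP/measurable_funTS.
rewrite -{1}oppr0 ge0_integration_by_substitutionNy//.
exact: continuous_subspaceT.
Qed.

Variables (P : probability (measurableTypeR R) R) (p : R -> R).
Hypothesis p_ge0 : forall x, 0 <= p x.
Hypothesis p_cont : continuous p.
Hypothesis p_even : forall x, p (- x) = p x.
Hypothesis PE : forall A, measurable A -> P A = (\int[mu]_(x in A) (p x)%:E)%E.

Let integrable_density : mu.-integrable [set: R] (EFin \o p).
Proof.
apply/integrableP; split.
  by apply/measurable_EFinP; exact: continuous_measurable_fun.
under eq_integral do rewrite /= ger0_norm//.
by rewrite -PE// probability_setT ltry.
Qed.

(* If the first moment diverges, the expectation is [+oo - +oo = -oo], which
   [fine] sends to 0, so no integrability is needed. *)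
Lemma fine_expectation_even_density : fine 'E_P[(idfun : R -> R)]%E = 0.
Proof.
rewrite unlock integralE.
have mid : measurable_fun [set: measurableTypeR R] (fun x : R => (idfun x)%:E).
  by apply/measurable_EFinP; exact: measurable_id.
rewrite (ge0_integral_density integrable_density)//; last first.
  exact: measurable_funepos.
rewrite (ge0_integral_density integrable_density)//; last first.
  exact: measurable_funeneg.
under eq_integral do rewrite funeposE -EFin_max -EFinM.
under [X in (_ - X)%E]eq_integral do rewrite funenegE -EFinN -EFin_max -EFinM.
(* Reflection exchanges the positive and the negative part of the identity, and [p] is even, so both
   parts have the same integral. *)
have -> : (\int[mu]_x (Num.max (idfun x) 0 * p x)%:E =
           \int[mu]_x (Num.max (- idfun x) 0 * p x)%:E)%E.
  rewrite (@ge0_integral_oppr (fun x => Num.max x 0 * p x)).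
  - by apply: eq_integral => x _; rewrite p_even.
  - by move=> x; rewrite mulr_ge0// le_max lexx orbT.
  - move=> x; apply: cvgM; last exact: p_cont.
    by apply: continuous_max; [exact: cvg_id|exact: cvg_cst].
case: (\int[mu]_x _)%E => [r||]//.
by rewrite subee.
Qed.

(** The centring constant is 0, so the variance is the second moment, whose integrand is even. *)
Lemma variance_even_density :
  law_variance P = (2%:E * \int[mu]_(x in `[0%R, +oo[) (x ^+ 2 * p x)%:E)%E.
Proof.
rewrite /law_variance /variance covariance.unlock.
rewrite fine_expectation_even_density unlock.
rewrite (ge0_integral_density integrable_density).
- rewrite /=; under eq_integral do rewrite !fctE /= subr0 -expr2 -EFinM.
  rewrite ge0_symfun_integralT -?set_itvcy//.
  + by move=> x; rewrite mulr_ge0// sqr_ge0.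
  + by move=> x; apply: cvgM; [exact: sqr_continuous|exact: p_cont].
  + by move=> x /=; rewrite sqrrN p_even.
- exact: PE.
- by move=> x; rewrite lee_fin -expr2 sqr_ge0.
- apply/measurable_EFinP; rewrite /=.
  by apply: measurable_funM; apply: measurable_funB => //;
    exact: measurable_id.
Qed.

End symmetric_density.

(** * Exponential decay and the variance of the Laplace law *)

Section moments.
Context {R : realType}.
Notation mu := (@lebesgue_measure R).

(** The term of degree n + 1 in the exponential series bounds e^(c x) from below, so the product is
    at most C / x with C = (n + 1)! / c^(n + 1). *)
Lemma cvgy_expr_expRN n (c : R) : 0 < c ->
  x ^+ n * expR (- (c * x)) @[x --> +oo] --> (0 : R).
Proof.
move=> c0; pose C := (n.+1)`!%:R / c ^+ n.+1.
have C0 : 0 < C by rewrite divr_gt0// ?exprn_gt0// ltr0n fact_gt0.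
have CV : C * x^-1 @[x --> +oo] --> (0 : R).
  rewrite -[X in _ --> X](mulr0 C); apply: cvgM; first exact: cvg_cst.
  by apply/gtr0_cvgV0; [exact: nbhs_pinfty_gt|exact: cvg_id].
apply: (squeeze_cvgr _ (cvg_cst 0) CV); near=> x.
have x0 : 0 < x by [].
apply/andP; split; first by rewrite mulr_ge0 ?expR_ge0// exprn_ge0// ltW.
rewrite expRN ler_pdivrMr ?expR_gt0//.
have cx : (c * x) ^+ n.+1 / (n.+1)`!%:R <= expR (c * x).
  apply: le_trans (expR_ge1Dxn n (ltW (mulr_gt0 c0 x0))).
  by rewrite lerDr.
apply: le_trans (ler_wpM2l _ cx); last first.
  by rewrite mulr_ge0// ?invr_ge0 ltW.
rewrite le_eqVlt; apply/orP; left; apply/eqP.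
rewrite /C exprMn [x ^+ n.+1]exprS; field.
by rewrite !gt_eqF ?exprn_gt0// ltr0n fact_gt0.
Unshelve. all: by end_near. Qed.

Lemma variance_laplace (b : R) : 0 < b ->
  law_variance (laplace_prob 0 b) = (2 * b ^+ 2)%:E.
Proof.
move=> b0; rewrite (@variance_even_density _ _ (laplace_pdf 0 b))//.
- pose F (x : R) := - (2^-1 * x ^+ 2 + b * x + b ^+ 2) * expR (- (b^-1 * x)).
  have dF x : is_derive x (1 : R) F
    (x ^+ 2 * ((b *+ 2)^-1 * expR (- (b^-1 * x)))).
    rewrite /F; apply: is_derive_eq.
    rewrite /GRing.scale/=; field; lra.
  (* [F] tends to 0 at +oo and [F 0] is - b^2, so the half-line contributes b^2. *)
  have -> : (\int[mu]_(x in `[0%R, +oo[) (x ^+ 2 * laplace_pdf 0 b x)%:E =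
    0%:E - (F 0)%:E)%E.
    apply: ge0_continuous_FTC2y.
    + by move=> x x0; rewrite mulr_ge0 ?sqr_ge0// laplace_pdf_ge0.
    + apply: continuous_subspaceT => x.
      by apply: cvgM; [exact: sqr_continuous|exact: continuous_laplace_pdf].
    (* Each summand is brought to the shape of [cvgy_expr_expRN], with exponents 2, 1 and 0; the
       limit 0 is then rewritten as the matching combination of zeros. *)
    + have -> : F = (fun x => - (2^-1 * (x ^+ 2 * expR (- (b^-1 * x))) +
          b * (x ^+ 1 * expR (- (b^-1 * x))) +
          b ^+ 2 * (x ^+ 0 * expR (- (b^-1 * x))))).
        by apply/funext => x; rewrite /F expr1 expr0; ring.
      have b1 : 0 < b^-1 by rewrite invr_gt0.
      rewrite (_ : 0 = - (2^-1 * 0 + b * 0 + b ^+ 2 * 0)); last by ring.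
      apply: (@cvgN _ R^o); apply: (@cvgD _ R^o); first apply: (@cvgD _ R^o);
        by apply: cvgM; [exact: cvg_cst|exact: cvgy_expr_expRN].
    + by move=> x x0; exact: ex_derive.
    + apply: cvg_at_right_filter; apply: differentiable_continuous.
      by apply/derivable1_diffP; exact: ex_derive.
    + move=> x; rewrite in_itv/= andbT => x0.
      rewrite derive1E derive_val /laplace_pdf b0 subr0 gtr0_norm//.
      by rewrite [b^-1 * x]mulrC.
  rewrite -EFinB -EFinM; congr EFin; rewrite /F.
  by rewrite !mulr0 oppr0 expR0; ring.
- exact: laplace_pdf_ge0.
- exact: continuous_laplace_pdf.
- by move=> x; rewrite /laplace_pdf b0 !subr0 normrN.
Qed.

(** * Distribution function and variance of the centred normal law *)

Lemma normal_pdf0E (s : R) : s != 0 -> normal_pdf 0 s =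
  fun x => normal_peak s * expR (- (x ^+ 2 / (s ^+ 2 *+ 2))).
Proof.
move=> s0; apply/funext => x.
by rewrite /normal_pdf (negbTE s0) /normal_fun subr0 mulNr.
Qed.

Lemma is_derive_normal_pdf (s x : R) : s != 0 ->
  is_derive x (1 : R) (normal_pdf 0 s) (- (x / s ^+ 2 * normal_pdf 0 s x)).
Proof.
move=> s0; rewrite normal_pdf0E//; apply: is_derive_eq.
rewrite /GRing.scale/=; field.
by [].
Qed.

(** For s = 1 this is [Phi] by conversion, so the facts below apply to [Phi] as they stand. *)
Definition normal_cdf (s x : R) : R := fine (normal_prob 0 s `]-oo, x]).

Lemma is_derive_normal_cdf (s x : R) : s != 0 ->
  is_derive x (1 : R) (normal_cdf s) (normal_pdf 0 s x).
Proof.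
move=> s0.
(* The fundamental theorem wants [x] inside the interval of integrability; [x + 1] is an arbitrary
   point to its right. *)
have [||||dG GE] := @continuous_FTC1 R (normal_pdf 0 s) -oo%O x (x + 1).
- by rewrite ltrDl.
- by apply: integrableS (integrable_normal_pdf 0 s).
- by rewrite ltNyr.
- exact: continuous_normal_pdf.
by split => //; rewrite -GE derive1E.
Qed.

Lemma continuous_normal_cdf (s : R) : s != 0 -> continuous (normal_cdf s).
Proof.
move=> s0 x; apply: differentiable_continuous; apply/derivable1_diffP.
by have [] := is_derive_normal_cdf x s0.
Qed.

(** The identity as a random variable: its [cdf] under [normal_prob 0 s] is [normal_cdf s] before
    [fine], which transfers the limits at both infinities. *)
Let idTR : measurableTypeR R -> R := idfun.

#[local] HB.instance Definition _ :=
  @isMeasurableFun.Build _ _ _ _ idTR (@measurable_id _ _ setT).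

Lemma cvgy_normal_cdf (s : R) : normal_cdf s x @[x --> +oo] --> (1 : R).
Proof.
exact/fine_cvg/(@cvg_cdfy1 _ _ _ (normal_prob 0 s) idTR).
Qed.

Lemma cvgNy_normal_cdf (s : R) : normal_cdf s x @[x --> -oo] --> (0 : R).
Proof.
exact/fine_cvg/(@cvg_cdfNy0 _ _ _ (normal_prob 0 s) idTR).
Qed.

Lemma normal_cdf_nondecreasing (s : R) : nondecreasing_fun (normal_cdf s).
Proof.
move=> x y xy; apply: fine_le; rewrite ?fin_num_measure//.
by rewrite le_measure ?inE//; exact: subitvPr.
Qed.

Lemma normal_pdfN (s x : R) : s != 0 -> normal_pdf 0 s (- x) = normal_pdf 0 s x.
Proof. by move=> s0; rewrite normal_pdf0E// sqrrN. Qed.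

(** By symmetry the total mass 1 is twice the mass of the positive half-line, which is 1 -
    [normal_cdf s 0]. *)
Lemma normal_cdf0 (s : R) : s != 0 -> normal_cdf s 0 = 2^-1.
Proof.
move=> s0; have := @integral_normal_pdf R 0 s.
rewrite ge0_symfun_integralT; last 3 first.
- exact: normal_pdf_ge0.
- exact: continuous_normal_pdf.
- by move=> x /=; rewrite normal_pdfN.
rewrite -set_itvcy (@ge0_continuous_FTC2y _ _ (normal_cdf s) 0 1).
- by rewrite -EFinB -EFinM => -[]; lra.
- by move=> x _; exact: normal_pdf_ge0.
- by apply: continuous_subspaceT; exact: continuous_normal_pdf.
- exact: cvgy_normal_cdf.
- by move=> x _; have [] := is_derive_normal_cdf x s0.
- by apply: cvg_at_right_filter; exact: continuous_normal_cdf.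
- by move=> x _; rewrite derive1E; have [] := is_derive_normal_cdf x s0.
Qed.

(** From x = 1 on, x <= x^2, so the Gaussian factor lies below e^(- c x) with c = 1 / (2 s^2), and
    exponential decay applies. *)
Lemma cvgy_mul_normal_pdf (s : R) : s != 0 ->
  x * normal_pdf 0 s x @[x --> +oo] --> (0 : R).
Proof.
move=> s0; pose c := (s ^+ 2 *+ 2)^-1.
have c0 : 0 < c by rewrite invr_gt0 mulrn_wgt0// exprn_even_gt0.
have CV : normal_peak s * (x ^+ 1 * expR (- (c * x))) @[x --> +oo] --> (0 : R).
  rewrite -[X in _ --> X](mulr0 (normal_peak s)).
  by apply: cvgM; [exact: cvg_cst|exact: cvgy_expr_expRN].
apply: (squeeze_cvgr _ (cvg_cst 0) CV); near=> x.
have x0 : 0 < x by [].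
have x1 : 1 <= x by near: x; exact: nbhs_pinfty_ge.
rewrite mulr_ge0 ?normal_pdf_ge0 ?(ltW x0)//= normal_pdf0E//.
rewrite mulrCA expr1 ler_wpM2l ?normal_peak_ge0// ler_wpM2l ?(ltW x0)//.
rewrite ler_expR lerN2 -/c mulrC ler_wpM2r ?(ltW c0)//.
by rewrite expr2 ler_peMr// ltW.
Unshelve. all: by end_near. Qed.

Lemma variance_normal (s : R) : s != 0 ->
  law_variance (normal_prob 0 s) = (s ^+ 2)%:E.
Proof.
move=> s0; rewrite (@variance_even_density _ _ (normal_pdf 0 s))//.
- pose F (x : R) := s ^+ 2 * (normal_cdf s x - x * normal_pdf 0 s x).
  (* The derivative of [normal_cdf s] cancels one term of the product rule; what is left is - s^2 x
     p' = x^2 p, where p is the density. *)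
  have dF x : is_derive x (1 : R) F (x ^+ 2 * normal_pdf 0 s x).
    have dp := is_derive_normal_pdf x s0.
    have dG := is_derive_normal_cdf x s0.
    by apply: is_derive_eq; rewrite /GRing.scale/=; field.
  (* [F] tends to s^2 at +oo, and [F 0] is s^2 / 2 by [normal_cdf0]; the half-line contributes s^2 /
     2. *)
  have -> : (\int[mu]_(x in `[0%R, +oo[) (x ^+ 2 * normal_pdf 0 s x)%:E =
    (s ^+ 2)%:E - (F 0)%:E)%E.
    apply: ge0_continuous_FTC2y.
    + by move=> x x0; rewrite mulr_ge0 ?sqr_ge0// normal_pdf_ge0.
    + apply: continuous_subspaceT => x.
      by apply: cvgM; [exact: sqr_continuous|exact: continuous_normal_pdf].
    + rewrite -[X in _ --> X](mulr1 (s ^+ 2)); apply: cvgM.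
        exact: cvg_cst.
      rewrite -[X in _ --> X]subr0; apply: (@cvgB _ R^o).
        exact: cvgy_normal_cdf.
      exact: cvgy_mul_normal_pdf.
    + by move=> x x0; exact: ex_derive.
    + apply: cvg_at_right_filter; apply: differentiable_continuous.
      by apply/derivable1_diffP; exact: ex_derive.
    + by move=> x _; rewrite derive1E derive_val.
  rewrite -EFinB -EFinM; congr EFin; rewrite /F normal_cdf0//.
  by rewrite mul0r subr0; field.
- exact: normal_pdf_ge0.
- exact: continuous_normal_pdf.
- by move=> x; exact: normal_pdfN.
Qed.

End moments.

(** * Inverting the standard normal distribution function *)

Lemma Phi_invK (R : realType) (y x : R) :
  0 < y -> y <= Phi x -> Phi (Phi_inv y) = y.
Proof.
move=> y0 yx; have n10 := oner_neq0 R.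
apply: pinvK; rewrite inE.
(* [pinv] is a right inverse on the range of [Phi], so [y] must be shown to be a value. The limit 0
   at -oo gives a lower point [z], the given [x] is the upper one, and the intermediate value
   theorem applies between them. *)
have [z zx zy] : exists2 z, z <= x & Phi z <= y.
  near (-oo : set_system R) => z; exists z.
    by near: z; apply: nbhs_ninfty_le; exact: num_real.
  apply: ltW; near: z; apply: cvgr_lt y0; exact: cvgNy_normal_cdf.
have [||w _ <-] := @IVT _ Phi z x y zx.
- by apply: continuous_subspaceT; exact: continuous_normal_cdf.
- by rewrite ge_min zy le_max yx orbT.
by exists w.
Unshelve. all: by end_near. Qed.

(** * Comparison of the two noise laws *)

Theorem lemma11 (R : realType) (D : Type) (d : D -> D -> nat) (s : D -> R)
    (Delta eps delta : R) :
  global_sensitivity d s = Delta%:E -> 0 < Delta ->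
  0 < eps -> 0 < delta < 1 ->
  delta < 2 * Phi (- Num.sqrt 2) ->
  (law_variance (laplace_noise Delta eps)
     < law_variance (gaussian_noise Delta eps delta))%E
  /\ 2 * (Delta / eps) ^+ 2 < gaussian_sigma Delta eps delta ^+ 2.
Proof.
move=> _ Delta0 eps0 /andP[delta0 _] deltalt.
have dPhi : delta / 2 < Phi (- Num.sqrt 2) by rewrite ltr_pdivrMr// mulrC.
set sigma := gaussian_sigma Delta eps delta.
have b0 : 0 < Delta / eps by rewrite divr_gt0.
have sigmaE : Num.sqrt 2 * (Delta / eps) < sigma.
  rewrite /sigma /gaussian_sigma; set z := Phi_inv (delta / 2).
  have zlt : z < - Num.sqrt 2.
    have PK : Phi z = delta / 2 by apply: Phi_invK (ltW dPhi); rewrite divr_gt0.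
    rewrite ltNge; apply/negP => zge.
    have : Phi (- Num.sqrt 2) <= Phi z := normal_cdf_nondecreasing 1 zge.
    by rewrite PK leNgt dPhi.
  (* As z < 0, - z is the square root of z^2, and adding 2 [eps] strictly increases it. *)
  have tlt : - z < Num.sqrt (z ^+ 2 + 2 * eps).
    have z0 : z < 0 by apply: lt_le_trans zlt _; rewrite oppr_le0 sqrtr_ge0.
    have e0 : 0 < 2 * eps by rewrite mulr_gt0.
    by rewrite -(ltr0_norm z0) -sqrtr_sqr ltr_sqrt ?ltrDl// ltr_wpDl ?sqr_ge0.
  (* Written as a multiple of [Delta / eps], [sigma] has a factor above (- z - z) / 2 = - z, hence
     above sqrt 2. *)
  have -> : (2 * eps)^-1 * Delta * (Num.sqrt (z ^+ 2 + 2 * eps) - z) =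
            ((Num.sqrt (z ^+ 2 + 2 * eps) - z) / 2) * (Delta / eps).
    by field; rewrite gt_eqF.
  by rewrite ltr_pM2r//; lra.
have main : 2 * (Delta / eps) ^+ 2 < sigma ^+ 2.
  rewrite -{1}(@sqr_sqrtr R 2)// -exprMn ltr_pXn2r// nnegrE.
    by rewrite mulr_ge0 ?sqrtr_ge0 ?(ltW b0).
  by apply: le_trans (ltW sigmaE); rewrite mulr_ge0 ?sqrtr_ge0 ?(ltW b0).
split => //; rewrite variance_laplace// variance_normal ?lte_fin// gt_eqF//.
(* The goal left is 0 < [sigma], the nondegeneracy condition of [variance_normal]. *)
by apply: le_lt_trans sigmaE; rewrite mulr_ge0 ?sqrtr_ge0 ?(ltW b0).
Qed.
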